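(* If $\mathbf{C}$ is a rotating non-shrinking soliton, i.e. a soliton with parameters $\alpha\geq0$, $\mathcal{A}$ antisymmetric and $\mathbf{v}=0$, then both ends of $\mathbf{C}$ are unbounded: \[ \lim_{s\to\pm\infty}\|\mathbf{C}(s)\|=\infty. \]
   Context: A soliton with parameters $\alpha\in\mathbb{R}$, $\mathcal{A}$ a real antisymmetric $n\times n$ matrix, and $\mathbf{v}=0$ is a smooth curve $\mathbf{C}:\mathbb{R}\to\mathbb{R}^n$, parametrized by arc length $s$, satisfying $\mathbf{C}_{ss}=(\alpha+\mathcal{A})\mathbf{C}+\lambda\mathbf{C}_s$, where $\alpha$ stands for $\alpha$ times the identity and $\lambda(s)=-\langle(\alpha+\mathcal{A})\mathbf{C},\mathbf{C}_s\rangle$ is determined by $\mathbf{C}_s\perp\mathbf{C}_{ss}$. *)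

(* Defs.v *)
From HB Require Import structures.
From mathcomp Require Import all_boot all_order all_algebra.
From mathcomp Require Import all_classical all_reals all_analysis.

Set Implicit Arguments.
Unset Strict Implicit.
Unset Printing Implicit Defensive.

Import Order.TTheory GRing.Theory Num.Theory.
Import numFieldNormedType.Exports.

Local Open Scope classical_set_scope.
Local Open Scope ring_scope.

(* The library norm `|u| on matrices is the sup norm, so the Euclidean
   structure is defined here. Derivatives only depend on the topology, which
   is the same for both norms. *)
Definition dotv {R : realType} {n : nat} (u v : 'cV[R]_n) : R :=
  \sum_(i < n) u i ord0 * v i ord0.

Definition enorm {R : realType} {n : nat} (u : 'cV[R]_n) : R :=
  Num.sqrt (dotv u u).

(* derive1 is total, so derivability is required at every order. *)
Definition smooth_curve {R : realType} {n : nat} (C : R -> 'cV[R]_n) : Prop :=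
  forall (k : nat) (s : R), derivable (derive1n k C) s 1.

Definition antisymmetric_mx {R : realType} {n : nat} (A : 'M[R]_n) : Prop :=
  A^T = - A.

Definition soliton_lambda {R : realType} {n : nat}
    (alpha : R) (A : 'M[R]_n) (C : R -> 'cV[R]_n) (s : R) : R :=
  - dotv ((alpha%:M + A) *m C s) (derive1 C s).

(* Solitons with translation vector v = 0. Since C is parametrized by arc
   length, the value of lambda is the one forced by the orthogonality of
   C_s and C_ss. *)
Record soliton {R : realType} {n : nat}
    (alpha : R) (A : 'M[R]_n) (C : R -> 'cV[R]_n) : Prop := Soliton {
  soliton_smooth : smooth_curve C;
  soliton_arclength : forall s : R, enorm (derive1 C s) = 1;
  soliton_eq : forall s : R,
    derive1n 2 C s = (alpha%:M + A) *m C s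
               + soliton_lambda alpha A C s *: derive1 C s }.

(* Main.v *)
Require Import Defs.
From HB Require Import structures.
From mathcomp Require Import all_boot all_order all_algebra.
From mathcomp Require Import all_classical all_reals all_analysis.
From mathcomp Require Import ring lra.

Set Implicit Arguments.
Unset Strict Implicit.
Unset Printing Implicit Defensive.

Import Order.TTheory GRing.Theory Num.Theory.
Import numFieldNormedType.Exports.

Local Open Scope classical_set_scope.
Local Open Scope ring_scope.

(** The squared distance [f = |C|^2] to the origin satisfies, because [A] is
antisymmetric and [C] has unit speed,
<<
  f'  = 2 <C, C_s>,      f'' = 2 + 2 alpha f + lambda f' >= 2 + lambda f'.
>>
Wherever [f' = 0] one has [f'' >= 2 > 0], so [f'] can cross zero only upwards
([derive_barrier]): once nonnegative it remains so, and [f] is monotone near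
each end.

It remains to see that [f] is unbounded near each end ([radial_unbounded]). If
[f <= M] on a half-line, then [lambda] is bounded there by some [K > 0]
([soliton_lambda_bound]), hence [f'' >= 1] as long as [|f'| <= 1/K]. The same
crossing argument at the levels [1/K] and [- 1/K] leaves three cases:
[f' >= 1/K] eventually, and [f] is unbounded above; [f'] eventually stays in
[[- 1/K, 1/K[] although it grows at unit rate, which is absurd; or
[f' < - 1/K] throughout, and [f] becomes negative.

The end [s --> -oo] follows by the reflection [s |-> - s], which preserves the
differential inequality with [- lambda (- s)] in place of [lambda]. *)

(** * Barriers and growth for differentiable functions *)

Lemma gt0_derive_near_right (R : realType) (g : R -> R) (p d : R) :
  is_derive p 1 g d -> 0 < d -> \forall x \near p^'+, g p < g x.
Proof.
move=> [gp dE] d_gt0.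
have /cvgrPdist_lt/(_ _ d_gt0) : h^-1 *: ((g \o shift p) (h%:A) - g p)
    @[h --> 0^'] --> d by rewrite -dE; exact: gp.
move=> [e /= e_gt0 He].
near=> x.
have px : 0 < x - p by rewrite subr_gt0; near: x; exact: nbhs_right_gt.
have xe : ball_ Num.norm 0 e (x - p).
  rewrite /ball_/= sub0r normrN gtr0_norm//.
  by near: x; exact: nbhs_right_ltDr.
have /= := He _ xe (lt0r_neq0 px).
rewrite [_%:A]mulr1 subrK => /ltr_normlW.
rewrite ltrBlDr ltrDl => gx.
by rewrite -subr_gt0 -(pmulr_rgt0 _ (_ : 0 < (x - p)^-1)) ?invr_gt0.
Unshelve. all: by end_near. Qed.

(** A function whose derivative is positive wherever it takes the value [c]
cannot cross that level downwards. If [g b < c], the last point of [[a, b]]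
where [c <= g] is followed by other such points, a contradiction. *)
Lemma derive_barrier (R : realType) (g dg : R -> R) (a c : R) :
  (forall x : R, is_derive x 1 g (dg x)) -> c <= g a ->
  (forall x, a <= x -> g x = c -> 0 < dg x) ->
  forall x, a <= x -> c <= g x.
Proof.
move=> gD ga dg_gt0 b ab; rewrite leNgt; apply/negP => gb.
have gC : continuous g.
  move=> x; apply/differentiable_continuous/derivable1_diffP.
  by have [] := gD x.
pose A := [set x | a <= x <= b] `&` g @^-1` [set y | c <= y].
have Aa : A a by split => //=; rewrite lexx.
have supA : has_sup A by split; [exists a | exists b => x [/andP[]]].
have clA : closed A.
  apply: closedI.
    rewrite (_ : [set x | _] = [set` `[a, b]]); first exact: itv_closed.
    by apply/seteqP; split => x /=; rewrite in_itv.
  by apply: preimage_closed; [move=> x _; exact: gC | exact: closed_ge].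
have Ap : A (sup A).
  apply: (itv_closed_supremums _ clA); first by exists a.
  split=> [|x ubx]; first exact: sup_upper_bound.
  by apply: ge_sup; first exists a.
set p := sup A in Ap.
have [/andP[ap pb] /= gp] := Ap.
have {}pb : p < b.
  by rewrite lt_neqAle pb andbT; apply: contraTneq gp => ->; rewrite -ltNge.
(* Beyond [p], use continuity if [c < g p] and the derivative if [g p = c]. *)
have near_right : \forall x \near p^'+, c <= g x.
  move: gp; rewrite le_eqVlt => /predU1P[gpE|gp].
    near do rewrite gpE ltW//.
    by apply: gt0_derive_near_right (gD p) _; exact: dg_gt0.
  near do apply: ltW.
  have /cvgr_gt : g x @[x --> p^'+] --> g p by apply/cvg_at_right_filter/gC.
  exact.
have [x [[px xb] gx]] : exists x, (p < x /\ x < b) /\ c <= g x.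
  apply: (@filter_ex _ (p^'+)).
  near=> x; split; [split|]; near: x => //.
  - exact: nbhs_right_gt.
  - exact: nbhs_right_lt.
have Ax : A x by split => //=; rewrite (le_trans ap (ltW px)) ltW.
by have := sup_upper_bound supA Ax; rewrite -/p leNgt px.
Unshelve. all: by end_near. Qed.

Lemma derive_ge_growth (R : realType) (f df : R -> R) (a b c : R) :
  (forall x : R, is_derive x 1 f (df x)) -> a <= b ->
  (forall x, a <= x -> c <= df x) -> f a + c * (b - a) <= f b.
Proof.
move=> fD ab dfc.
have [|x] := MVT_segment ab (fun x _ => fD x).
  by apply: derivable_within_continuous => x _; have [] := fD x.
rewrite in_itv /= => /andP[ax _] fE.
by rewrite -lerBrDl fE ler_wpM2r ?subr_ge0// dfc.
Qed.

Lemma derive_le_growth (R : realType) (f df : R -> R) (a b c : R) :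
  (forall x : R, is_derive x 1 f (df x)) -> a <= b ->
  (forall x, a <= x -> df x <= c) -> f b <= f a + c * (b - a).
Proof.
move=> fD ab dfc.
have fND (x : R) : is_derive x 1 (- f) (- df x) by apply: is_deriveN.
rewrite -lerN2 opprD -mulNr.
by apply: (derive_ge_growth fND ab) => x ax; rewrite lerN2 dfc.
Qed.

(** * The differential inequality of the squared distance *)

(** Here [f] stands for the squared distance to the origin and [lam] for the
tangential coefficient of the soliton equation, which is only bounded where [f]
is. *)
Section radial.
Variables (R : realType) (f g dg lam : R -> R).
Hypothesis fD : forall x : R, is_derive x 1 f (g x).
Hypothesis gD : forall x : R, is_derive x 1 g (dg x).
Hypothesis f_ge0 : forall x, 0 <= f x.
Hypothesis dg_ge : forall x, 2 + lam x * g x <= dg x.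
Hypothesis lam_bnd : forall M, exists K, forall x, f x <= M -> `|lam x| <= K.

(** [f] is unbounded above on every half-line [[a, +oo[]. *)
Lemma radial_unbounded a M : exists2 x, a <= x & M < f x.
Proof.
apply: contrapT => nex.
have fM x : a <= x -> f x <= M.
  by move=> ax; rewrite leNgt; apply/negP => fx; apply: nex; exists x.
have [K0 lamK0] := lam_bnd M.
pose K := `|K0| + 1.
have K_gt0 : 0 < K by rewrite ltr_wpDl.
have lamK x : a <= x -> `|lam x| <= K.
  by move=> /fM/lamK0 /le_trans; apply; rewrite (le_trans (ler_norm _))// lerDl.
pose c := K^-1.
have c_gt0 : 0 < c by rewrite invr_gt0.
have dg_ge1 x : a <= x -> `|g x| <= c -> 1 <= dg x.
  move=> ax gx; apply: le_trans (dg_ge x).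
  have : `|lam x * g x| <= 1.
    by rewrite normrM -(mulfV (lt0r_neq0 K_gt0)) ler_pM// lamK.
  by rewrite ler_norml => /andP[+ _]; lra.
(* If [c <= g x], then [g] stays above [c], and [f] exceeds [M] at distance
   [(M + 1) / c] from [x]. *)
have g_lt x : a <= x -> g x < c.
  move=> ax; rewrite ltNge; apply/negP => gx.
  have gc y : x <= y -> c <= g y.
    apply: (derive_barrier gD gx) => z xz gz.
    by rewrite (lt_le_trans ltr01)// dg_ge1 ?gz ?gtr0_norm// (le_trans ax).
  have M_ge0 : 0 <= M by apply: le_trans (f_ge0 a) (fM _ _).
  have xb : x <= x + (M + 1) * K by rewrite lerDl mulr_ge0// ?ltW// ltr_wpDl.
  have := derive_ge_growth fD xb gc.
  rewrite [_ - x]addrC addKr /c mulrCA mulVf ?gt_eqF// mulr1.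
  by have := fM _ (le_trans ax xb); have := f_ge0 x; lra.
(* If [- c <= g x], then [g] stays in [[- c, c[] with slope at least [1], and
   reaches [c] at distance [2 * c] from [x]. *)
have g_ltN x : a <= x -> g x < - c.
  move=> ax; rewrite ltNge; apply/negP => gx.
  have gc y : x <= y -> - c <= g y.
    apply: (derive_barrier gD gx) => z xz gz.
    have az := le_trans ax xz.
    by rewrite (lt_le_trans ltr01)// dg_ge1 ?gz ?normrN ?gtr0_norm.
  have xb : x <= x + 2 * c by rewrite lerDl mulr_ge0// ltW.
  have dg1 y : x <= y -> 1 <= dg y.
    move=> xy; have ay := le_trans ax xy.
    by rewrite dg_ge1// ler_norml gc//= ltW// g_lt.
  have := derive_ge_growth gD xb dg1.
  by have := g_lt _ (le_trans ax xb); lra.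
(* Hence [g < - c] on [[a, +oo[], and [f] is negative at [a + (f a + 1) / c]. *)
have ab : a <= a + (f a + 1) * K by rewrite lerDl mulr_ge0// ?ltW// ltr_wpDl.
have := derive_le_growth fD ab (fun x ax => ltW (g_ltN x ax)).
rewrite [_ - a]addrC addKr /c mulNr mulrCA mulVf ?gt_eqF// mulr1.
by have := f_ge0 (a + (f a + 1) * K); lra.
Qed.

Lemma radial_cvgy : f x @[x --> +oo] --> +oo.
Proof.
(* If [g] were negative on [[0, +oo[], then [f] would be bounded by [f 0]. *)
have [a ga] : exists a, 0 <= g a.
  apply: contrapT => nex.
  have g_lt0 x : 0 <= x -> g x <= 0.
    move=> _; rewrite leNgt; apply/negP => gx.
    by apply: nex; exists x; exact: ltW.
  have [x x_ge0 fx] := radial_unbounded 0 (f 0).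
  by have := derive_le_growth fD x_ge0 g_lt0; rewrite mul0r addr0 leNgt fx.
have g_ge0 x : a <= x -> 0 <= g x.
  apply: (derive_barrier gD ga) => y ay gy.
  by apply: lt_le_trans (dg_ge y); rewrite gy mulr0 addr0.
apply/cvgryPge => M.
have [x ax fx] := radial_unbounded a M.
near=> y.
have xy : x <= y by near: y; apply: nbhs_pinfty_ge; exact: num_real.
apply: le_trans (ltW fx) _.
have := derive_ge_growth fD xy (fun z xz => g_ge0 z (le_trans ax xz)).
by rewrite mul0r addr0.
Unshelve. all: by end_near. Qed.

End radial.

Lemma radial_cvgNy (R : realType) (f g dg lam : R -> R) :
  (forall x : R, is_derive x 1 f (g x)) ->
  (forall x : R, is_derive x 1 g (dg x)) ->
  (forall x, 0 <= f x) ->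
  (forall x, 2 + lam x * g x <= dg x) ->
  (forall M, exists K, forall x, f x <= M -> `|lam x| <= K) ->
  f x @[x --> -oo] --> +oo.
Proof.
move=> fD gD f_ge0 dg_ge lam_bnd.
have fND (x : R) : is_derive x 1 (f \o -%R) (- g (- x)).
  apply: (is_derive_eq (is_derive1_comp (fD (- x)) (is_deriveNid x 1))).
  by rewrite mulrN1.
have gND (x : R) : is_derive x 1 (- (g \o -%R)) (dg (- x)).
  have gN := is_derive1_comp (gD (- x)) (is_deriveNid x 1).
  apply: (is_derive_eq (is_deriveN gN)).
  by rewrite mulrN1 opprK.
apply/cvgNy_compNP.
apply: (@radial_cvgy _ _ _ _ (fun x => - lam (- x)) fND gND) => [x|x|M].
- exact: f_ge0.
- by rewrite mulrNN; exact: dg_ge.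
- by have [K lamK] := lam_bnd M; exists K => x fM; rewrite normrN lamK.
Qed.

(** * The Euclidean inner product *)

Lemma is_derive_entry (R : realType) (m n : nat) (M : R -> 'M[R]_(m, n)) (x : R)
    i j :
  derivable M x 1 -> is_derive x 1 (fun s => M s i j) (derive1 M x i j).
Proof.
move=> Mx; apply: DeriveDef; first exact: (derivable_mxP _ _ _).1.
by rewrite derive1E derive_mx// mxE.
Qed.

Lemma is_derive_dotv (R : realType) (n : nat) (U V : R -> 'cV[R]_n) (x : R) :
  derivable U x 1 -> derivable V x 1 ->
  is_derive x 1 (fun s => dotv (U s) (V s))
    (dotv (derive1 U x) (V x) + dotv (U x) (derive1 V x)).
Proof.
move=> Ux Vx.
pose h i (s : R) : R := U s i ord0 * V s i ord0.
rewrite [X in is_derive _ _ X _](_ : _ = \sum_(i < n) h i); last first.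
  by apply/funext => s; rewrite fct_sumE.
rewrite /dotv -big_split/=.
apply: is_derive_sum => i.
have UxD := is_derive_entry i ord0 Ux.
have VxD := is_derive_entry i ord0 Vx.
apply: (is_derive_eq (is_deriveM UxD VxD)).
by rewrite /GRing.scale/= addrC [V x i ord0 * _]mulrC.
Qed.

Section dot_product.
Variables (R : realType) (n : nat).
Implicit Types (u v w : 'cV[R]_n) (A : 'M[R]_n).

Lemma dotvC u v : dotv u v = dotv v u.
Proof. by apply: eq_bigr => i _; rewrite mulrC. Qed.

Lemma dotvDl u v w : dotv (u + v) w = dotv u w + dotv v w.
Proof.
by rewrite /dotv -big_split; apply: eq_bigr => i _; rewrite mxE mulrDl.
Qed.

Lemma dotvZl k u v : dotv (k *: u) v = k * dotv u v.
Proof.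
by rewrite /dotv mulr_sumr; apply: eq_bigr => i _; rewrite mxE mulrA.
Qed.

Lemma dotvE u v : dotv u v = (u^T *m v) ord0 ord0.
Proof. by rewrite mxE; apply: eq_bigr => i _; rewrite mxE. Qed.

Lemma dotv_ge0 u : 0 <= dotv u u.
Proof. by apply: sumr_ge0 => i _; rewrite -expr2 sqr_ge0. Qed.

Lemma sqr_entry_le_dotv u i : u i ord0 ^+ 2 <= dotv u u.
Proof.
rewrite /dotv (bigD1 i)//= -expr2 lerDl.
by apply: sumr_ge0 => j _; rewrite -expr2 sqr_ge0.
Qed.

Lemma dotv_antisym A u : antisymmetric_mx A -> dotv (A *m u) u = 0.
Proof.
move=> AT.
have E : dotv (A *m u) u = - dotv (A *m u) u.
  by rewrite {1}dotvE trmx_mul AT mulmxN mulNmx mxE -mulmxA -dotvE dotvC.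
lra.
Qed.

(** A crude bound suffices: entries of the unit vector [v] are at most [1] in
absolute value, those of [u] at most [1 + M]. *)
Lemma dotv_mul_bound A u v (M : R) : dotv u u <= M -> dotv v v = 1 ->
  `|dotv (A *m u) v| <= \sum_i \sum_j `|A i j| * (1 + M).
Proof.
move=> uM v1; apply: le_trans (ler_norm_sum _ _ _) _; apply: ler_sum => i _.
have v_le1 : `|v i ord0| <= 1.
  by rewrite -(@expr_le1 _ 2)// real_normK ?num_real// -v1 sqr_entry_le_dotv.
rewrite normrM; apply: (@le_trans _ _ `|(A *m u) i ord0|).
  by rewrite ler_piMr.
rewrite mxE; apply: le_trans (ler_norm_sum _ _ _) _; apply: ler_sum => j _.
rewrite normrM ler_wpM2l//.
have := le_trans (sqr_entry_le_dotv u j) uM.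
rewrite -(real_normK (num_real _)).
by have := sqr_ge0 `|u j ord0|; have := sqr_ge0 (`|u j ord0| - 1); lra.
Qed.

End dot_product.

(** * The squared distance of a soliton to the origin *)

Section soliton.
Variables (R : realType) (n : nat) (alpha : R) (A : 'M[R]_n).
Variable C : R -> 'cV[R]_n.
Hypothesis A_antisym : antisymmetric_mx A.
Hypothesis C_soliton : soliton alpha A C.

Let f s := dotv (C s) (C s).
Let g s := 2 * dotv (C s) (derive1 C s).
Let lam := soliton_lambda alpha A C.
Let dg s := 2 + 2 * alpha * f s + lam s * g s.

Lemma soliton_unit_tangent s : dotv (derive1 C s) (derive1 C s) = 1.
Proof.
have := soliton_arclength C_soliton s.
rewrite /enorm => /(congr1 (fun x => x ^+ 2)).
by rewrite sqr_sqrtr ?dotv_ge0// expr1n.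
Qed.

Lemma is_derive_soliton_sqnorm (s : R) : is_derive s 1 f (g s).
Proof.
have [smoothC _ _] := C_soliton.
have Cs : derivable C s 1 := smoothC 0%N s.
apply: (is_derive_eq (is_derive_dotv Cs Cs)).
by rewrite dotvC /g -mulr2n mulr_natl.
Qed.

(** Antisymmetry enters here: [<C, A C> = 0], so that [A] contributes to [f'']
only through [lambda]. *)
Lemma is_derive_soliton_sqnorm' (s : R) : is_derive s 1 g (dg s).
Proof.
have [smoothC _ _] := C_soliton.
have Cs : derivable C s 1 := smoothC 0%N s.
have C's : derivable (derive1 C) s 1 := smoothC 1%N s.
apply: (is_derive_eq (is_deriveZ 2 (is_derive_dotv Cs C's))).
have -> : derive1 (derive1n 1 C) s = derive1n 2 C s by [].
rewrite (soliton_eq C_soliton) soliton_unit_tangent dotvC dotvDl dotvZl.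
rewrite mulmxDl dotvDl (dotv_antisym _ A_antisym) mul_scalar_mx dotvZl addr0.
rewrite /GRing.scale/=.
rewrite (dotvC (derive1 C s)) -/lam -/(f s) /dg /g; ring.
Qed.

Lemma soliton_lambda_bound M :
  exists K, forall s, f s <= M -> `|lam s| <= K.
Proof.
exists (\sum_i \sum_j `|(alpha%:M + A) i j| * (1 + M)) => s fM.
by rewrite /lam /soliton_lambda normrN dotv_mul_bound// soliton_unit_tangent.
Qed.

End soliton.

Lemma cvg_enormy (R : realType) (n : nat) (T : Type) (F : set_system T)
    (u : T -> 'cV[R]_n) : Filter F ->
  dotv (u x) (u x) @[x --> F] --> +oo -> enorm (u x) @[x --> F] --> +oo.
Proof.
move=> FF /cvgryPge uy; apply/cvgryPge => M.
apply: filterS (uy (M ^+ 2)) => x.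
by move=> /ler_wsqrtr; rewrite sqrtr_sqr; apply: le_trans; exact: ler_norm.
Qed.

Theorem lemma6p3 (R : realType) (n : nat) (alpha : R) (A : 'M[R]_n)
    (C : R -> 'cV[R]_n)
    (alpha_ge0 : 0 <= alpha) (A_antisym : antisymmetric_mx A)
    (C_soliton : soliton alpha A C) :
  enorm (C s) @[s --> +oo] --> +oo /\ enorm (C s) @[s --> -oo] --> +oo.
Proof.
pose f s := dotv (C s) (C s).
pose g s := 2 * dotv (C s) (derive1 C s).
pose lam := soliton_lambda alpha A C.
pose dg s := 2 + 2 * alpha * f s + lam s * g s.
have fD : forall s : R, is_derive s 1 f (g s).
  exact: is_derive_soliton_sqnorm C_soliton.
have gD : forall s : R, is_derive s 1 g (dg s).
  exact: is_derive_soliton_sqnorm' C_soliton.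
have f_ge0 s : 0 <= f s by exact: dotv_ge0.
have dg_ge s : 2 + lam s * g s <= dg s.
  by rewrite /dg lerD2r lerDl mulr_ge0// mulr_ge0.
have lam_bnd := soliton_lambda_bound C_soliton.
split; apply: cvg_enormy.
  exact: (radial_cvgy fD gD f_ge0 dg_ge lam_bnd).
exact: (radial_cvgNy fD gD f_ge0 dg_ge lam_bnd).
Qed.
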